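(* (Relations between $\Psi$ and $\Phi$.) For any composition $I$, in $\mathcal NSym$ we have $$\Phi^I=(-1)^{\ell(I)}\sum_{J\succeq I}\Big(\sum_{J\succeq L\succeq I}\frac{(-1)^{\ell(L)}\,\pi(I)}{\pi_u(J,L)\,\ell(L,I)}\Big)\Psi^J,$$ $$\Psi^I=(-1)^{\ell(I)}\sum_{J\succeq I}\Big(\sum_{J\succeq L\succeq I}\frac{(-1)^{\ell(L)}\,lp(L,I)}{sp(J,L)}\Big)\Phi^J,$$ where $J$ and $L$ range over compositions.
   Context: $K$ is a unital commutative $\mathbb Q$-algebra and $t$ a central formal parameter. $\mathcal NSym$ is the free unital associative $K$-algebra on noncommuting variables $\Lambda_m$ ($m\ge1$), $\Lambda_0=1$, $\lambda(t)=\sum_{m\ge0}t^m\Lambda_m$. Elements $S_m,\Phi_m,\Psi_m,\Xi_m$ of $\mathcal NSym$ are defined by $\sigma(t)=\sum_{m\ge0}t^mS_m$, $\Phi(t)=\sum_{m\ge1}t^m\Phi_m/m$, $\psi(t)=\sum_{m\ge1}t^{m-1}\Psi_m$, $\xi(t)=\sum_{m\ge1}t^{m-1}\Xi_m$, the unique solutions in $\mathcal NSym[[t]]$ of $\lambda(-t)\sigma(t)=\sigma(t)\lambda(-t)=1$, $e^{\Phi(t)}=\sigma(t)$, $\frac{d\sigma(t)}{dt}=\sigma(t)\psi(t)=\xi(t)\sigma(t)$. A composition is a nonempty finite sequence $I=(i_1,\dots,i_m)$ of positive integers; $\ell(I)=m$, $|I|=\sum i_j$. For a sequence $w=\{w_k\}$,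 $w^I=w_{i_1}\cdots w_{i_m}$. $lp(I)=i_m$, $\pi(I)=\prod_ji_j$, $\pi_u(I)=\prod_{j=1}^m(i_1+\cdots+i_j)$, $sp(I)=\ell(I)!\,\pi(I)$. $J\succeq I$ means $J$ is a refinement of $I$: $J$ is the concatenation $J_1\cdot J_2\cdots J_m$ of compositions $J_a$ with $|J_a|=i_a$; then $\ell(J,I)=\prod_a\ell(J_a)$, $\pi_u(J,I)=\prod_a\pi_u(J_a)$, $sp(J,I)=\prod_asp(J_a)$, $lp(J,I)=\prod_alp(J_a)$. *)

(* Defs.v *)
From HB Require Import structures.
From mathcomp Require Import all_boot all_order all_algebra.
From mathcomp Require Import finmap monalg.

Set Implicit Arguments.
Unset Strict Implicit.
Unset Printing Implicit Defensive.

Import GRing.Theory.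

Local Open Scope ring_scope.

Definition is_composition (I : seq nat) : bool :=
  (I != [::]) && all (ltn 0) I.

(* The compositions of n.+2 are obtained from those of n.+1 by prepending a
   part 1 or by increasing the first part. *)
Definition incr_head (I : seq nat) : seq nat := (head 0%N I).+1 :: behead I.

Fixpoint compositions (n : nat) : seq (seq nat) :=
  match n with
  | 0 => [::]
  | 1 => [:: [:: 1%N]]
  | m.+1 => [seq 1%N :: J | J <- compositions m]
              ++ [seq incr_head J | J <- compositions m]
  end.

Lemma mem_compositions n I :
  (I \in compositions n) = is_composition I && (sumn I == n).
Proof.
elim: n I => [|n IHn] I.
  by case: I => [|[|i] I] /=; rewrite ?addSn ?andbF.
have base J : (J \in compositions 1) = is_composition J && (sumn J == 1%N).
  rewrite inE; case: J => [|[|[|i]] [|[|j] J]] //=;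
    by rewrite ?addSn ?andbF.
case: n IHn => [|n] IHn; first exact: base.
rewrite /compositions -/(compositions n.+1) mem_cat.
apply/orP/idP => [[]/mapP[J]|].
- rewrite IHn => /andP[/andP[nJ pJ] /eqP sJ] ->.
  by rewrite /is_composition /= pJ sJ add1n eqxx.
- rewrite IHn => /andP[/andP[nJ pJ] /eqP sJ] ->.
  by case: J nJ pJ sJ => // -[//|i] J _ /= pJ sJ;
    rewrite /is_composition /= pJ addSn sJ eqxx.
case: I => [//|[//|[|i]] I] /andP[/andP[_ /= pI] /eqP sI].
  left; apply/mapP; exists I => //; rewrite IHn /is_composition pI.
  by case: I sI {pI} => //= j I; rewrite add1n => -[->]; rewrite eqxx.
right; apply/mapP; exists (i.+1 :: I) => //.
by rewrite IHn /is_composition /= pI -eqSS -addSn; apply/eqP.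
Qed.

Lemma compositions_uniq n : uniq (compositions n).
Proof.
elim: n => [//|[//|n] IHn].
rewrite /compositions -/(compositions n.+1) cat_uniq.
rewrite map_inj_in_uniq; last by move=> I J _ _ [].
rewrite IHn andTb map_inj_in_uniq ?IHn ?andbT.
  apply/hasPn => _ /mapP[J hJ ->]; apply/mapP => -[I _ []].
  by move: hJ; rewrite mem_compositions; case: J => [//|[|j] J].
move=> I J; rewrite !mem_compositions.
by case: I => [//|i I]; case: J => [//|j J] _ _ [-> ->].
Qed.

Definition comp_pi (I : seq nat) : nat := (\prod_(i <- I) i)%N.
Definition comp_pi_u (I : seq nat) : nat :=
  (\prod_(j < size I) sumn (take j.+1 I))%N.
Definition comp_sp (I : seq nat) : nat := ((size I)`! * comp_pi I)%N.
Definition comp_lp (I : seq nat) : nat := last 0%N I.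

(* When J is the concatenation of compositions J_1, ..., J_m with
   |J_a| = i_a, blocks J I is the list [:: J_1; ...; J_m] (see blocksE): the
   first block is the shortest prefix of J of weight at least i_1. *)
Fixpoint blocks (J I : seq nat) : seq (seq nat) :=
  if I is i :: I' then
    let k := find (fun k => i <= sumn (take k J))%N (iota 0 (size J)) in
    take k J :: blocks (drop k J) I'
  else [::].

Definition refines (J I : seq nat) : bool :=
  [&& all is_composition (blocks J I),
      map sumn (blocks J I) == I & flatten (blocks J I) == J].

Lemma blocksE (Js : seq (seq nat)) :
  all is_composition Js -> blocks (flatten Js) (map sumn Js) = Js.
Proof.
elim: Js => //= J Js IH /andP[/andP[nJ pJ] aJs].
have cutP k : (k < size J)%N -> (sumn (take k J) < sumn J)%N.
  move=> ltk; rewrite -{2}(cat_take_drop k J) sumn_cat -[X in (X < _)%N]addn0.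
  rewrite ltn_add2l; move: pJ ltk.
  by rewrite -{1}(cat_take_drop k J) all_cat -subn_gt0 -size_drop;
    case: (drop k J) => //= x s /and3P[_ x0 _] _; rewrite addn_gt0 x0.
suff -> : find (fun k => sumn J <= sumn (take k (J ++ flatten Js)))%N
            (iota 0 (size (J ++ flatten Js))) = size J.
  by rewrite take_size_cat // drop_size_cat // IH.
rewrite size_cat iotaD find_cat add0n.
case: hasP => [[k]|_].
  rewrite mem_iota add0n => /andP[_ ltk].
  by rewrite takel_cat ?(ltnW ltk) // leqNgt cutP.
rewrite size_iota; case: (size (flatten Js)) => [|r] /=; rewrite ?addn0 //.
by rewrite take_size_cat // leqnn addn0.
Qed.

Lemma refinesP (J I : seq nat) :
  reflect (exists Js : seq (seq nat),
             [/\ all is_composition Js, map sumn Js = I & flatten Js = J])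
          (refines J I).
Proof.
apply: (iffP and3P) => [[aB /eqP sB /eqP fB]|[Js [aJ <- <-]]].
  by exists (blocks J I).
by rewrite blocksE.
Qed.

Lemma refines_compositions (J I : seq nat) :
  is_composition I -> refines J I -> J \in compositions (sumn I).
Proof.
move=> /andP[nI _] /refinesP[Js [aJ sJ fJ]]; rewrite mem_compositions -fJ -sJ.
rewrite sumn_flatten eqxx andbT /is_composition.
apply/andP; split.
  case: Js aJ sJ {fJ} => [_ sI|[|j J1] Js] //.
  by rewrite -sI in nI.
elim: Js aJ {sJ fJ} => //= J1 Js IH /andP[/andP[_ pJ1] aJs].
by rewrite all_cat pJ1 IH.
Qed.

Definition size_rel (J I : seq nat) : nat :=
  (\prod_(Ja <- blocks J I) size Ja)%N.
Definition pi_u_rel (J I : seq nat) : nat :=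
  (\prod_(Ja <- blocks J I) comp_pi_u Ja)%N.
Definition sp_rel (J I : seq nat) : nat :=
  (\prod_(Ja <- blocks J I) comp_sp Ja)%N.
Definition lp_rel (J I : seq nat) : nat :=
  (\prod_(Ja <- blocks J I) comp_lp Ja)%N.

(* The algebra NSym over a commutative rat-algebra K: the monoid algebra of
   the free monoid on nat, the letter m being the generator of index m.+1.  *)

Definition NSym (K : comAlgType rat) : predArgType := {malg K[{fmonom nat}]}.

HB.instance Definition _ (K : comAlgType rat) :=
  GRing.Lalgebra.copy (NSym K) {malg K[{fmonom nat}]}.

Fact NSym_scalerAr (K : comAlgType rat) (c : K) (x y : NSym K) :
  c *: (x * y) = x * (c *: y).
Proof.
apply/malgP => k; rewrite mcoeffZ mcoeffMl.
rewrite (mcoeffMlw _ (fsubset_refl (msupp x)) (msuppZ_le c y)).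
rewrite big_distrr /=; apply: eq_bigr => k1 _.
rewrite big_distrr /=; apply: eq_bigr => k2 _.
by rewrite mcoeffZ mulrnAr mulrCA.
Qed.

HB.instance Definition _ (K : comAlgType rat) :=
  GRing.Lalgebra_isAlgebra.Build K (NSym K) (@NSym_scalerAr K).

Definition Lambda (K : comAlgType rat) (m : nat) : NSym K :=
  if m is m'.+1 then << fmu m' >> else 1.

(* w^I, factors in the order of I *)
Definition monom (A : nzRingType) (w : nat -> A) (I : seq nat) : A :=
  \prod_(i <- I) w i.

(* Formal power series in a central variable t over a K-algebra A, given by
   their coefficients; they are compared with =1.                           *)

Section PowerSeries.

Variables (K : comAlgType rat) (A : algType K).
Implicit Types f g h : nat -> A.

Definition fps_one : nat -> A := fun n => (n == 0%N)%:R.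

Definition fps_mul f g : nat -> A :=
  fun n => \sum_(i < n.+1) f i * g (n - i)%N.

Definition fps_pow f (k : nat) : nat -> A := iter k (fps_mul f) fps_one.

(* f(-t) *)
Definition fps_opp_arg f : nat -> A := fun n => (-1) ^+ n * f n.

Definition fps_deriv f : nat -> A := fun n => f n.+1 *+ n.+1.

(* e^f = \sum_k f^k / k!, for f without constant term: the coefficient of
   t^n in f^k is then 0 when n < k. *)
Definition fps_exp f : nat -> A :=
  fun n => \sum_(k < n.+1) (k`!%:R^-1 : rat)%:A *: fps_pow f k n.

(* \sum_(m >= 1) t^m F_m / m *)
Definition fps_div_index (F : nat -> A) : nat -> A :=
  fun m => if m is 0 then 0 else (m%:R^-1 : rat)%:A *: F m.

(* \sum_(m >= 1) t^(m-1) F_m *)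
Definition fps_shift (F : nat -> A) : nat -> A := fun m => F m.+1.

Lemma fps_rec (F : (nat -> A) -> nat -> A) :
  (forall f g n, (forall i, (i < n)%N -> f i = g i) -> F f n = F g n) ->
  exists f, forall n, f n = F f n.
Proof.
move=> Floc.
pose s n := iter n (fun r => rcons r (F (nth 0 r) (size r))) [::].
have size_s n : size (s n) = n by elim: n => //= n IH; rewrite size_rcons IH.
have nth_s n i : (i < n)%N -> nth 0 (s n) i = nth 0 (s i.+1) i.
  elim: n => // n IH; rewrite ltnS leq_eqVlt => /orP[/eqP->//|lin].
  by rewrite /= nth_rcons size_s lin -/(s n) IH.
exists (fun n => nth 0 (s n.+1) n) => n.
rewrite /= nth_rcons size_s ltnn eqxx; apply: Floc => i lin.
by rewrite nth_s.
Qed.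

Lemma fps_mulA f g h : fps_mul f (fps_mul g h) =1 fps_mul (fps_mul f g) h.
Proof.
move=> n; pose P (f : nat -> A) : {poly A} := \poly_(i < n.+1) f i.
have PM f1 f2 k : (k <= n)%N -> fps_mul f1 f2 k = (P f1 * P f2)`_k.
  move=> lekn; rewrite coefM; apply: eq_bigr => i _.
  by rewrite !coef_poly !ltnS (leq_trans (leq_ord i)) // (leq_trans (leq_subr _ _)).
have -> : fps_mul f (fps_mul g h) n = (P f * (P g * P h))`_n.
  rewrite coefM; apply: eq_bigr => i _.
  by rewrite PM ?leq_subr // coef_poly ltnS leq_ord.
rewrite mulrA coefM; apply: eq_bigr => i _.
by rewrite PM ?leq_ord // coef_poly ltnS leq_subr.
Qed.

Lemma fps_mul1 f : fps_mul fps_one f =1 f.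
Proof.
move=> n; rewrite /fps_mul big_ord_recl mul1r subn0 big1 ?addr0 // => i _.
by rewrite mul0r.
Qed.

Lemma fps_mulr1 f : fps_mul f fps_one =1 f.
Proof.
move=> n; rewrite /fps_mul big_ord_recr /= subnn mulr1 big1 ?add0r // => i _.
by rewrite /fps_one subn_eq0 leqNgt ltn_ord mulr0.
Qed.

Lemma eq_fps_mul f f' g g' :
  f =1 f' -> g =1 g' -> fps_mul f g =1 fps_mul f' g'.
Proof. by move=> ef eg n; apply: eq_bigr => i _; rewrite ef eg. Qed.

Lemma fps_solve f h : f 0%N = 1 -> exists g, fps_mul f g =1 h.
Proof.
move=> f0.
have [|g gE] := @fps_rec
    (fun g n => h n - \sum_(i < n) f i.+1 * g (n - i.+1)%N).
  move=> g g' n egg'; congr (_ - _); apply: eq_bigr => i _.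
  by rewrite egg' // ltn_subrL /= (leq_ltn_trans _ (ltn_ord i)).
exists g => n; rewrite /fps_mul big_ord_recl f0 mul1r subn0 gE.
by rewrite subrK.
Qed.

Lemma fps_solve_l f h : f 0%N = 1 -> exists g, fps_mul g f =1 h.
Proof.
move=> f0.
have [|g gE] := @fps_rec (fun g n => h n - \sum_(i < n) g i * f (n - i)%N).
  move=> g g' n egg'; congr (_ - _); apply: eq_bigr => i _.
  by rewrite egg'.
exists g => n; rewrite /fps_mul big_ord_recr /= subnn f0 mulr1 gE addrC.
by rewrite subrK.
Qed.

Lemma fps_pow_loc f g n k : f 0%N = 0 -> g 0%N = 0 ->
  (forall i, (i < n)%N -> f i = g i) ->
  (forall i, (i < n)%N -> fps_pow f k i = fps_pow g k i) /\
  fps_pow f k n - fps_pow g k n = if k == 1%N then f n - g n else 0.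
Proof.
move=> f0 g0 efg.
have loc i : (i < n)%N -> fps_pow f k i = fps_pow g k i.
  elim: k i => //= k IH i lin; apply: eq_bigr => j _.
  rewrite efg ?(leq_ltn_trans (leq_ord j)) // IH //.
  by rewrite (leq_ltn_trans (leq_subr _ _)).
split=> //; case: k loc => [|[|k]] loc; rewrite ?subrr //.
  by rewrite /= !fps_mulr1.
rewrite [fps_pow f _]/(fps_mul f (fps_pow f k.+1)).
rewrite [fps_pow g _]/(fps_mul g (fps_pow g k.+1)).
have p0 h : h 0%N = 0 -> fps_pow h k.+1 0%N = 0.
  by move=> h0; rewrite /= /fps_mul big_ord1 h0 mul0r.
have loc' i : (i < n)%N -> fps_pow f k.+1 i = fps_pow g k.+1 i.
  move: i {loc}; elim: k.+1 => //= m IH i lin; apply: eq_bigr => j _.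
  rewrite efg ?(leq_ltn_trans (leq_ord j)) // IH //.
  by rewrite (leq_ltn_trans (leq_subr _ _)).
apply/eqP; rewrite subr_eq0; apply/eqP; apply: eq_bigr => i _.
have [->|i0] := eqVneq (val i) 0%N; first by rewrite f0 g0 !mul0r.
have [->|ni] := eqVneq (val i) n; first by rewrite subnn !p0 // !mulr0.
have lin : (i < n)%N by rewrite ltn_neqAle ni leq_ord.
by rewrite efg // loc' // ltn_subrL lt0n i0 (leq_ltn_trans _ lin).
Qed.

Lemma fps_log h : h 0%N = 1 -> exists f, f 0%N = 0 /\ fps_exp f =1 h.
Proof.
move=> h0.
pose trunc f n i : A := if ((0 < i) && (i < n))%N then f i else 0.
have [|f fE] := @fps_rec
    (fun f n => if n is 0 then 0 else h n - fps_exp (trunc f n) n).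
  move=> f g [//|n] efg; congr (_ - _).
  have etr : trunc f n.+1 =1 trunc g n.+1.
    by move=> i; rewrite /trunc; case: ifP => // /andP[_ /efg].
  have epow m : fps_pow (trunc f n.+1) m =1 fps_pow (trunc g n.+1) m.
    by elim: m => //= m IH; apply: eq_fps_mul.
  by apply: eq_bigr => k _; rewrite epow.
have f0 : f 0%N = 0 by rewrite fE.
exists f; split=> // -[|n].
  by rewrite /fps_exp big_ord1 fact0 invr1 !scale1r h0.
have tr0 : trunc f n.+1 0%N = 0 by [].
have loc i : (i < n.+1)%N -> f i = trunc f n.+1 i.
  by rewrite /trunc => ->; case: i => [|i]; rewrite ?f0.
have trn : trunc f n.+1 n.+1 = 0 by rewrite /trunc ltnn.
apply/eqP; rewrite -subr_eq0; apply/eqP.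
suff : fps_exp f n.+1 - fps_exp (trunc f n.+1) n.+1 = f n.+1.
  by move/eqP; rewrite subr_eq [in X in _ == X]fE subrK => /eqP ->; rewrite subrr.
rewrite /fps_exp -sumrB.
rewrite (eq_bigr (fun k : 'I_n.+2 => if val k == 1%N then f n.+1 else 0)).
  by rewrite -big_mkcond (big_pred1 (Ordinal (isT : 1 < n.+2)%N)).
move=> k _; rewrite -scalerBr (fps_pow_loc k f0 tr0 loc).2 trn subr0.
by case: eqP => [->|_]; rewrite ?scaler0 // factS fact0 invr1 !scale1r.
Qed.

Lemma fps_families_exist f : f 0%N = 1 -> exists S Phi Psi : nat -> A,
  [/\ fps_mul f S =1 fps_one, fps_mul S f =1 fps_one,
      fps_exp (fps_div_index Phi) =1 S
    & fps_deriv S =1 fps_mul S (fps_shift Psi)].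
Proof.
move=> l0.
have [S SE] := fps_solve fps_one l0.
have [T TE] := fps_solve_l fps_one l0.
have ST : S =1 T.
  move=> n; rewrite -fps_mul1 -(eq_fps_mul TE (fun=> erefl)) -fps_mulA.
  by rewrite (eq_fps_mul (fun=> erefl) SE) fps_mulr1.
have S0 : S 0%N = 1 by move: (SE 0%N); rewrite /fps_mul big_ord1 l0 mul1r.
have [Q [Q0 QE]] := fps_log S0.
have [P PE] := fps_solve (fps_deriv S) S0.
exists S, (fun m => (m%:R : rat)%:A *: Q m), (fun m => P m.-1).
split; first exact: SE; last by move=> n; rewrite -PE.
  by move=> n; rewrite (eq_fps_mul ST (fun=> erefl)) TE.
have QD : fps_div_index (fun m => (m%:R : rat)%:A *: Q m) =1 Q.
  case=> [|m]; first by rewrite Q0.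
  rewrite /fps_div_index !scalerA -scalerAl mul1r scalerA mulVf ?scale1r //.
  by rewrite Num.Theory.pnatr_eq0.
have powD m : fps_pow (fps_div_index (fun m => (m%:R : rat)%:A *: Q m)) m
                =1 fps_pow Q m.
  by elim: m => //= m IH; apply: eq_fps_mul.
by move=> n; rewrite -QE; apply: eq_bigr => k _; rewrite powD.
Qed.

End PowerSeries.

(* The families S, Phi and Psi exist; the values Phi 0 and Psi 0 are
   irrelevant. *)
Lemma NSym_families_exist (K : comAlgType rat) :
  exists S Phi Psi : nat -> NSym K,
  [/\ fps_mul (fps_opp_arg (Lambda K)) S =1 fps_one (NSym K),
      fps_mul S (fps_opp_arg (Lambda K)) =1 fps_one (NSym K),
      fps_exp (fps_div_index Phi) =1 S
    & fps_deriv S =1 fps_mul S (fps_shift Psi)].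
Proof. by apply: fps_families_exist; rewrite /fps_opp_arg mulr1. Qed.

(* Main.v *)
From HB Require Import structures.
Require Import Defs.
From mathcomp Require Import all_boot all_order all_algebra.
From mathcomp Require Import finmap monalg.

Set Implicit Arguments.
Unset Strict Implicit.
Unset Printing Implicit Defensive.

Import GRing.Theory.

Local Open Scope ring_scope.

(** Both identities are obtained by passing through the [S_m].

    In one direction, [S_n] is a rational combination over the compositions
    [J] of [n]: of the [Psi^J] with weights [1 / pi_u(J)] ([S_Psi], by
    iterating [n S_n = \sum_i S_i Psi_(n - i)], which peels off the last part
    of [J]), and of the [Phi^J] with weights [1 / sp(J)] ([S_Phi], which is the
    exponential series).  In the other direction, [Phi_n] is a combination of
    the [S^L], read off from the logarithm series ([Phi_S]), and so is
    [Psi_n], read off from [psi = sigma^-1 sigma'] ([Psi_S]).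

    Substituting one expansion into the other and multiplying over the parts
    of [I] is formal ([monom_change]): choosing independently a composition of
    each part of [I] is the same as choosing a refinement of [I]
    ([prod_compositions_sum]), so [Y^I] is a sum over [L] refining [I] of
    [S^L], each of which is a sum over [J] refining [L] of [X^J]; transitivity
    of refinement allows the two sums to be exchanged.  All weights attached
    to a pair of compositions are products over blocks, which is why they come
    out of this multiplication.

    The logarithm in a noncommutative algebra reduces to one variable: the
    powers of a fixed series commute, so [log (exp x) = x], proved for
    truncated polynomials over the rationals by differentiating
    ([log_exp_poly]), can be evaluated at that series ([fps_log_exp]). *)

(** * Sums over compositions *)

(** Unlike [compositions], contains the empty sequence for [n = 0]; this is
    what makes the recursions on the first or last part uniform. *)
Definition compositions0 (n : nat) : seq (seq nat) :=
  if n is 0 then [:: [::]] else compositions n.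

Lemma mem_compositions0 n J :
  (J \in compositions0 n) = all (ltn 0) J && (sumn J == n).
Proof.
case: n => [|n]; first by case: J => [|[|j] J]; rewrite inE //= addSn andbF.
by rewrite mem_compositions /is_composition; case: J.
Qed.

Lemma compositions0_uniq n : uniq (compositions0 n).
Proof. by case: n => [//|n]; apply: compositions_uniq. Qed.

(** Common form of the two recursions below: [f i] inserts a part [i], at the
    front or at the back. *)
Lemma sum_compositions_part (V : nmodType) (f : nat -> seq nat -> seq nat)
    (G : seq nat -> V) n :
    (forall i j I J, f i I = f j J -> i = j /\ I = J) ->
    (forall i J, all (ltn 0) (f i J) = (0 < i)%N && all (ltn 0) J) ->
    (forall i J, sumn (f i J) = (i + sumn J)%N) ->
    (forall J, J != [::] -> exists i J', J = f i J') ->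
  \sum_(J <- compositions0 n.+1) G J =
  \sum_(i < n.+1) \sum_(J <- compositions0 (n - i)) G (f i.+1 J).
Proof.
move=> finj fpos fsum fsurj.
have eqp : perm_eq (compositions0 n.+1)
    [seq f i.+1 J | i <- iota 0 n.+1, J <- compositions0 (n - i)].
  apply: uniq_perm; first exact: compositions0_uniq.
    apply: allpairs_uniq_dep => [|i _|]; rewrite ?iota_uniq ?compositions0_uniq //.
    by move=> [i I] [j J] _ _ /= /finj[[->] ->].
  move=> J; rewrite mem_compositions0; apply/andP/allpairsPdep.
    move=> [pJ /eqP sJ]; have /fsurj[[|i] [J' eJ]] : J != [::] by case: J sJ {pJ}.
      by rewrite eJ fpos in pJ.
    move: pJ sJ; rewrite eJ fpos fsum addSn => /andP[_ pJ'] [sJ].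
    exists i, J'; rewrite mem_iota add0n mem_compositions0 pJ' -sJ addKn eqxx.
    by rewrite ltnS leq_addr.
  move=> [i [J' [+ + ->]]]; rewrite mem_iota add0n ltnS mem_compositions0.
  by move=> lein /andP[pJ' /eqP sJ']; rewrite fpos fsum pJ' sJ' addSn subnKC.
by rewrite (perm_big _ eqp) big_allpairs_dep -(big_mkord predT
  (fun i => \sum_(J <- compositions0 (n - i)) G (f i.+1 J))) /index_iota subn0.
Qed.

Lemma sum_compositions_head (V : nmodType) (G : seq nat -> V) n :
  \sum_(J <- compositions0 n.+1) G J =
  \sum_(i < n.+1) \sum_(J <- compositions0 (n - i)) G (i.+1 :: J).
Proof.
apply: (@sum_compositions_part _ cons) => //; first by move=> i j I J [-> ->].
by case=> // i J; exists i, J.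
Qed.

Lemma sum_compositions_last (V : nmodType) (G : seq nat -> V) n :
  \sum_(J <- compositions0 n.+1) G J =
  \sum_(i < n.+1) \sum_(J <- compositions0 (n - i)) G (rcons J i.+1).
Proof.
apply: (@sum_compositions_part _ (fun i J => rcons J i)).
- by move=> i j I J /rcons_inj[-> ->].
- by move=> i J; rewrite all_rcons.
- by move=> i J; rewrite sumn_rcons addnC.
- by case/lastP => // J i; exists i, J.
Qed.

(** * Refinements as lists of blocks *)

(** Refinements of [I] are handled through their lists of blocks, which form a
    Cartesian product and therefore match the expansion of a product of sums. *)
Fixpoint blockings (I : seq nat) : seq (seq (seq nat)) :=
  if I is i :: I' then [seq J :: Js | J <- compositions i, Js <- blockings I']
  else [:: [::]].

Lemma mem_blockings I Js :
  (Js \in blockings I) = all is_composition Js && (map sumn Js == I).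
Proof.
elim: I Js => [|i I IH] Js; first by case: Js => [|J Js]; rewrite inE //= andbF.
apply/allpairsP/andP => [[[J Js'] /= [+ + ->]]|].
  rewrite mem_compositions IH => /andP[cJ /eqP <-] /andP[cJs /eqP <-].
  by rewrite /= cJ cJs.
case: Js => [[]//|J Js] /= [/andP[cJ cJs] /eqP[sJ sJs]]; exists (J, Js).
by rewrite mem_compositions cJ sJ IH cJs sJs !eqxx.
Qed.

Lemma blockings_uniq I : uniq (blockings I).
Proof.
elim: I => //= i I IH; apply: allpairs_uniq => //; first exact: compositions_uniq.
by move=> [J Js] [J' Js'] _ _ /= [-> ->].
Qed.

Lemma flatten_blockingsK I Js : Js \in blockings I -> blocks (flatten Js) I = Js.
Proof. by rewrite mem_blockings => /andP[cJs /eqP <-]; apply: blocksE. Qed.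

Lemma sum_refines (V : nmodType) (G : seq nat -> V) I : is_composition I ->
  \sum_(J <- compositions (sumn I) | refines J I) G J =
  \sum_(Js <- blockings I) G (flatten Js).
Proof.
move=> cI; rewrite -big_filter -(big_map flatten predT G); apply: perm_big.
apply: uniq_perm.
- exact/filter_uniq/compositions_uniq.
- rewrite map_inj_in_uniq ?blockings_uniq // => Js Js' hJs hJs' eJ.
  by rewrite -(flatten_blockingsK hJs) eJ flatten_blockingsK.
move=> J; rewrite mem_filter; apply/andP/mapP => [[]|[Js]].
  move=> /refinesP[Js [cJs sJs fJs]] _; exists Js => //.
  by rewrite mem_blockings cJs sJs eqxx.
rewrite mem_blockings => /andP[cJs /eqP sJs] ->.
have rJ : refines (flatten Js) I by apply/refinesP; exists Js.
by split=> //; apply: refines_compositions.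
Qed.

Lemma prod_sum_blockings (R : nzRingType) (h : seq nat -> R) I :
  \prod_(i <- I) \sum_(J <- compositions i) h J =
  \sum_(Js <- blockings I) \prod_(J <- Js) h J.
Proof.
elim: I => [|i I IH]; first by rewrite big_nil big_seq1 big_nil.
rewrite big_cons IH big_allpairs_dep mulr_suml; apply: eq_bigr => J _.
by rewrite mulr_sumr; apply: eq_bigr => Js _; rewrite big_cons.
Qed.

Lemma refines_sumn J I : refines J I -> sumn J = sumn I.
Proof. by move=> /refinesP[Js [_ <- <-]]; rewrite sumn_flatten. Qed.

Lemma is_composition_flatten Js :
  all is_composition Js -> Js != [::] -> is_composition (flatten Js).
Proof.
move=> cJs nJs; have hI : is_composition (map sumn Js).
  rewrite /is_composition -size_eq0 size_map size_eq0 nJs.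
  elim: Js cJs {nJs} => //= J Js IH /andP[/andP[nJ pJ] /IH ->].
  by case: J nJ pJ => //= j J _ /andP[j0 _]; rewrite andbT addn_gt0 j0.
have /(refines_compositions hI): refines (flatten Js) (map sumn Js).
  by apply/refinesP; exists Js.
by rewrite mem_compositions => /andP[].
Qed.

(** The blocks of [J] over [L] are grouped according to the blocks of [L] over
    [I], and each group is concatenated. *)
Lemma refines_trans J L I : refines J L -> refines L I -> refines J I.
Proof.
move=> /refinesP[Js [cJs sJs <-]] /refinesP[Ls [cLs sLs fLs]].
pose Jss := reshape (shape Ls) Js.
have szJs : size Js = sumn (shape Ls).
  by rewrite -size_flatten fLs -sJs size_map.
have fJss : flatten Jss = Js by rewrite reshapeKr // szJs.
have sumJss : map (map sumn) Jss = Ls.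
  by rewrite -[Ls]flattenK fLs -sJs /Jss map_reshape.
apply/refinesP; exists (map flatten Jss); split.
- rewrite all_map; apply/allP => Bs Bs_in /=; apply: is_composition_flatten.
    apply/allP => B B_in; apply: (allP cJs); rewrite -fJss.
    by apply/flattenP; exists Bs.
  have /(allP cLs)/andP[+ _] : map sumn Bs \in Ls by rewrite -sumJss map_f.
  by case: Bs {Bs_in}.
- rewrite -sLs -sumJss -!map_comp; apply: eq_map => Bs /=.
  by rewrite sumn_flatten.
- by rewrite -[in RHS]fJss; elim: Jss {sumJss fJss} => //= Bs Jss IH;
    rewrite IH flatten_cat.
Qed.

(** * The logarithm of the truncated exponential *)

Lemma coef_exp_small (R : nzRingType) (p q : {poly R}) k i :
  p`_0 = 0 -> (i < k)%N -> (p ^+ k * q)`_i = 0.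
Proof.
move=> p0; elim: k i => // k IH i lik; rewrite exprS -mulrA coefM.
rewrite big_ord_recl p0 mul0r add0r big1 // => j _.
rewrite ltnS in lik; rewrite IH ?mulr0 //; apply: leq_trans lik.
by rewrite ltn_subrL /= (leq_ltn_trans _ (ltn_ord j)).
Qed.

Definition exp_poly (N : nat) : {poly rat} :=
  \sum_(k < N.+1) (k`!%:R^-1 : rat) *: 'X^k.

Lemma coef_exp_poly N i :
  (exp_poly N)`_i = if (i <= N)%N then i`!%:R^-1 else 0.
Proof.
rewrite coef_sum (eq_bigr (fun k : 'I_N.+1 =>
  if k == i :> nat then (k`!%:R^-1 : rat) else 0)); last first.
  by move=> k _; rewrite coefZ coefXn eq_sym; case: eqP; rewrite ?mulr1 ?mulr0.
by rewrite -big_mkcond (big_ord1_eq +%R (fun k => (k`!%:R^-1 : rat))) ltnS.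
Qed.

Lemma deriv_exp_poly N :
  (exp_poly N)^`() = exp_poly N - (N`!%:R^-1 : rat) *: 'X^N.
Proof.
apply/polyP => i; rewrite coef_deriv coefB !coef_exp_poly coefZ coefXn.
case: ltngtP => [ltiN|ltNi|->].
- rewrite mulr0 subr0 -[LHS]mulr_natr factS natrM invfM mulrC mulrA mulfV ?mul1r //.
  by rewrite Num.Theory.pnatr_eq0.
- by rewrite mulr0 subr0 mul0rn.
- by rewrite mulr1 subrr mul0rn.
Qed.

(** With [g = exp_poly N - 1], the derivative of the left-hand side is a
    geometric sum times [g' = 1 + g - 'X^N / N!], hence [1] up to degree
    [N - 1].  The term of index [0] vanishes because division by zero gives
    zero; including it makes the sum a sum over all lengths of compositions
    later on. *)
Lemma log_exp_poly N i : (i <= N)%N ->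
  (\sum_(k < N.+1) ((-1) ^+ k.+1 / k%:R : rat) *: (exp_poly N - 1) ^+ k)`_i
    = (i == 1%N)%:R.
Proof.
set g := exp_poly N - 1; set L := \sum_(k < _) _.
have g0 : g`_0 = 0.
  by rewrite coefB coef_exp_poly fact0 invr1 coef1 subrr.
case: i => [_|i ltiN].
  rewrite coef_sum big1 // => -[[|k] ltk] _ /=; rewrite coefZ.
    by rewrite invr0 mulr0 mul0r.
  by rewrite -[g ^+ _]mulr1 coef_exp_small // mulr0.
have dg : g^`() = 1 + g - (N`!%:R^-1 : rat) *: 'X^N.
  by rewrite [1 + g]addrC subrK derivB deriv_exp_poly -polyC1 derivC subr0.
have dL : L^`() = g^`() * \sum_(k < N) (- g) ^+ k.
  rewrite raddf_sum big_ord_recl /= invr0 mulr0 scale0r deriv0 add0r.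
  rewrite mulr_sumr; apply: eq_bigr => k _.
  rewrite /bump /= add1n derivZ deriv_exp /= -scaler_nat scalerA.
  rewrite mulfVK ?Num.Theory.pnatr_eq0 // [(- g) ^+ k]exprNn 2!exprS !mulN1r opprK.
  by rewrite -mul_polyC rmorph_sign mulrCA.
have /(congr1 (fun p : {poly rat} => p`_i)) :
    L^`() = 1 - (- g) ^+ N - 'X^N * ((N`!%:R^-1 : rat) *: \sum_(k < N) (- g) ^+ k).
  (* (1 + g) times the geometric sum is 1 - (- g) ^+ N *)
  rewrite dL dg mulrBl -scalerAl -scalerAr; congr (_ - _).
  by rewrite -[LHS]opprK -mulNr opprD addrC [- g - 1]addrC addrC -subrX1 opprB.
rewrite coef_deriv !coefB coefXnM ltiN subr0 coef1 -[(- g) ^+ N]mulr1.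
rewrite coef_exp_small ?coefN ?g0 ?oppr0 // subr0 -[LHS]mulr_natr.
have i0 : i.+1%:R != 0 :> rat by rewrite Num.Theory.pnatr_eq0.
by move/(canRL (mulfK i0)) ->; case: i {ltiN i0} => [|i]; rewrite ?mul0r ?divr1.
Qed.

(** * Power series with coefficients in an algebra *)

Section RationalCombinations.

Variables (K : comAlgType rat) (A : algType K).
Implicit Types (f g : nat -> A) (x y : A).

Local Notation "q ** x" := (((q : rat)%:A : K) *: (x : A)) (at level 40).

Lemma ratsA (q r : rat) x : q ** (r ** x) = (q * r) ** x.
Proof. by rewrite scalerA -scalerAl mul1r scalerA. Qed.

Lemma rats_nat n x : n%:R ** x = x *+ n.
Proof. by rewrite scaler_nat scaler_nat. Qed.

Lemma rats_prod (T : Type) (s : seq T) (b : T -> rat) (h : T -> A) :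
  \prod_(i <- s) (b i ** h i) = (\prod_(i <- s) b i) ** \prod_(i <- s) h i.
Proof.
by rewrite scaler_prod; congr (_ *: _); rewrite -in_algE rmorph_prod.
Qed.

Lemma coef_exp_fps (p : {poly A}) f n :
    (forall i, (i <= n)%N -> p`_i = f i) ->
  forall k i, (i <= n)%N -> (p ^+ k)`_i = fps_pow f k i.
Proof.
move=> pf; elim=> [|k IH] i lein; first by rewrite coef1.
rewrite exprS coefM; apply: eq_bigr => j _.
rewrite pf ?IH // ?(leq_trans (leq_subr _ _)) //.
by apply: leq_trans lein; rewrite -ltnS.
Qed.

Lemma fps_pow_small f k i : f 0%N = 0 -> (i < k)%N -> fps_pow f k i = 0.
Proof.
move=> f0 lik; pose p : {poly A} := \poly_(j < i.+1) f j.
rewrite -(@coef_exp_fps p f i) // => [|j leji]; last by rewrite coef_poly ltnS leji.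
by rewrite -[p ^+ k]mulr1 coef_exp_small // coef_poly /= f0.
Qed.

Section RationalSubstitution.

Variable F : {poly A}.

(** Polynomials over the rationals can be evaluated at [F] although [A] is not
    commutative, because rational constants are central. *)
Definition rat_const : rat -> {poly A} := polyC \o (in_alg A \o in_alg K).

Lemma rat_const_comm : commr_rmorph rat_const F.
Proof.
move=> q; rewrite /GRing.comm /rat_const /=; apply/polyP => i.
by rewrite coefMC coefCM mulr_algr mulr_algl.
Qed.

Definition rat_subst : {poly rat} -> {poly A} := horner_morph rat_const_comm.

HB.instance Definition _ :=
  GRing.RMorphism.copy rat_subst (horner_morph rat_const_comm).

Lemma coef_rat_substZ (q : rat) (p : {poly rat}) i :
  (rat_subst (q *: p))`_i = q ** (rat_subst p)`_i.
Proof.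
by rewrite -mul_polyC rmorphM /= [rat_subst _%:P]horner_morphC coefCM mulr_algl.
Qed.

Lemma rat_substX : rat_subst 'X = F.
Proof. exact: horner_morphX. Qed.

(** Substituting a series without constant term is continuous for the [t]-adic
    topology, so truncations can be ignored. *)
Lemma eq_coef_rat_subst (p q : {poly rat}) n : F`_0 = 0 ->
    (forall i, (i <= n)%N -> p`_i = q`_i) ->
  (rat_subst p)`_n = (rat_subst q)`_n.
Proof.
move=> F0 epq; rewrite -[p](poly_take_drop n.+1) -[q](poly_take_drop n.+1).
have -> : take_poly n.+1 p = take_poly n.+1 q.
  by apply/polyP => i; rewrite !coef_take_poly ltnS; case: leqP => // /epq.
rewrite ![_ * 'X^_]mulrC !rmorphD !rmorphM /= !rmorphXn /= rat_substX !coefD.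
by rewrite !coef_exp_small.
Qed.

End RationalSubstitution.

(** [f = log (e^f)]; only the series [f] and its powers occur, so this is the
    one-variable identity evaluated at a truncation of [f]. *)
Lemma fps_log_exp f n : f 0%N = 0 ->
  f n = \sum_(k < n.+1) ((-1) ^+ k.+1 / k%:R) **
          fps_pow (fun m => fps_exp f m - fps_one A m) k n.
Proof.
move=> f0; pose F : {poly A} := \poly_(i < n.+1) f i.
have FE i : (i <= n)%N -> F`_i = f i by move=> lein; rewrite coef_poly ltnS lein.
have expE i : (i <= n)%N ->
    (rat_subst F (exp_poly n - 1))`_i = fps_exp f i - fps_one A i.
  move=> lein; rewrite rmorphB rmorph1 coefB coef1; congr (_ - _).
  rewrite rmorph_sum coef_sum /=.
  rewrite (eq_bigr (fun k : 'I_n.+1 => (k`!%:R^-1) ** fps_pow f k i)); last first.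
    by move=> k _; rewrite coef_rat_substZ rmorphXn /= rat_substX (coef_exp_fps FE).
  rewrite [RHS](big_ord_widen n.+1 (fun k => (k`!%:R^-1) ** fps_pow f k i)) //.
  rewrite [RHS]big_mkcond; apply: eq_bigr => k _; case: (ltnP k i.+1) => // lik.
  by rewrite fps_pow_small // scaler0.
pose L := \sum_(k < n.+1) ((-1) ^+ k.+1 / k%:R : rat) *: (exp_poly n - 1) ^+ k.
transitivity ((rat_subst F L)`_n); last first.
  rewrite rmorph_sum coef_sum /=; apply: eq_bigr => k _.
  by rewrite coef_rat_substZ rmorphXn /= (coef_exp_fps expE).
rewrite (@eq_coef_rat_subst F L 'X n) ?rat_substX ?FE // => i lein.
by rewrite log_exp_poly // coefX.
Qed.

(** * Expansions of S, Phi and Psi over compositions *)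

Lemma fps_pow_compositions g k n : g 0%N = 0 ->
  fps_pow g k n = \sum_(J <- compositions0 n | size J == k) monom g J.
Proof.
move=> g0; elim: k n => [|k IH] [|n].
- by rewrite big_cons big_nil /monom big_nil addr0.
- rewrite big1_seq // => J /andP[/nilP ->].
  by rewrite mem_compositions0.
- by rewrite big_cons big_nil /= /fps_mul big_ord1 g0 mul0r.
- rewrite /= /fps_mul big_ord_recl g0 mul0r add0r.
rewrite [RHS]big_mkcond sum_compositions_head; apply: eq_bigr => i _.
rewrite subSS IH mulr_sumr [LHS]big_mkcond; apply: eq_bigr => J _ /=.
by rewrite eqSS; case: eqP; rewrite // /monom big_cons.
Qed.

Lemma size_leq_sumn J : all (ltn 0) J -> (size J <= sumn J)%N.
Proof.
elim: J => //= j J IH /andP[j0 /IH leJ].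
by rewrite -add1n leq_add.
Qed.

Lemma sum_fps_pow (c : nat -> rat) g n : g 0%N = 0 ->
  \sum_(k < n.+1) c k ** fps_pow g k n =
  \sum_(J <- compositions0 n) c (size J) ** monom g J.
Proof.
move=> g0.
under eq_bigr => k _ do rewrite fps_pow_compositions // scaler_sumr.
rewrite (exchange_big_dep predT) //=; apply: eq_big_seq => J.
rewrite mem_compositions0 => /andP[pJ /eqP sJ].
under eq_bigl => k do rewrite eq_sym.
rewrite (big_ord1_eq +%R (fun k => c k ** monom g J)).
by rewrite ltnS -sJ size_leq_sumn.
Qed.

Lemma eq_monom_pos f g J :
  all (ltn 0) J -> (forall i, (0 < i)%N -> f i = g i) -> monom f J = monom g J.
Proof.
by move=> /allP pJ efg; apply: eq_big_seq => i /pJ; apply: efg.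
Qed.

Lemma monom_fps_div_index F J : all (ltn 0) J ->
  monom (fps_div_index F) J = ((comp_pi J)%:R^-1) ** monom F J.
Proof.
move=> pJ; rewrite (@eq_monom_pos _ (fun i => (i%:R^-1) ** F i)) //; last by case.
by rewrite /monom rats_prod /comp_pi natr_prod prodfV.
Qed.

Section Families.

Variables S Phi Psi : nat -> A.

Hypothesis hPhi : fps_exp (fps_div_index Phi) =1 S.
Hypothesis hPsi : fps_deriv S =1 fps_mul S (fps_shift Psi).

Lemma S_coef0 : S 0%N = 1.
Proof. by rewrite -hPhi /fps_exp big_ord1 fact0 invr1 !scale1r. Qed.

Lemma S_Phi n :
  S n = \sum_(J <- compositions0 n) ((comp_sp J)%:R^-1) ** monom Phi J.
Proof.
rewrite -hPhi /fps_exp (sum_fps_pow (fun k => k`!%:R^-1)) //.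
apply: eq_big_seq => J; rewrite mem_compositions0 => /andP[pJ _].
by rewrite monom_fps_div_index // ratsA /comp_sp natrM invfM.
Qed.

Lemma Phi_S n : (0 < n)%N ->
  Phi n = - \sum_(L <- compositions n)
              ((-1) ^+ size L * (sumn L)%:R / (size L)%:R) ** monom S L.
Proof.
case: n => // n _; have := fps_log_exp n.+1 (erefl : fps_div_index Phi 0%N = 0).
rewrite (sum_fps_pow (fun k => (-1) ^+ k.+1 / k%:R)); last first.
  by rewrite hPhi S_coef0 subrr.
have n0 : n.+1%:R != 0 :> rat by rewrite Num.Theory.pnatr_eq0.
move=> /(congr1 (fun x => n.+1%:R ** x)); rewrite ratsA mulfV // !scale1r => ->.
rewrite -sumrN scaler_sumr; apply: eq_big_seq => L.
rewrite mem_compositions0 => /andP[pL /eqP sL]; rewrite ratsA sL.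
rewrite (@eq_monom_pos _ S) // => [|i i0]; last first.
  by rewrite hPhi /fps_one; case: i i0 => // i _; rewrite subr0.
rewrite -scaleNr -scaleNr; congr ((_ *: _) *: _).
by rewrite exprS mulN1r mulNr mulrN mulrA [n.+1%:R * _]mulrC.
Qed.

Lemma S_Psi_rec n : S n.+1 *+ n.+1 = \sum_(i < n.+1) S i * Psi (n - i).+1.
Proof. exact: hPsi. Qed.

Lemma comp_pi_u_rcons J j :
  comp_pi_u (rcons J j) = (comp_pi_u J * (sumn J + j))%N.
Proof.
rewrite /comp_pi_u size_rcons big_ord_recr /=; congr (_ * _)%N.
  apply: eq_bigr => i _; rewrite -cats1 takel_cat //.
by rewrite take_oversize ?size_rcons // sumn_rcons.
Qed.

(** The recursion of [S_Psi_rec] removes the last part [j] of a composition of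
    [n]; [pi_u] is then divided by its last partial sum, which is [n]. *)
Lemma S_Psi n :
  S n = \sum_(J <- compositions0 n) ((comp_pi_u J)%:R^-1) ** monom Psi J.
Proof.
elim/ltn_ind: n => -[_|n IH].
  by rewrite big_seq1 S_coef0 /monom big_nil /comp_pi_u big_ord0 invr1 !scale1r.
have n0 : n.+1%:R != 0 :> rat by rewrite Num.Theory.pnatr_eq0.
have -> : S n.+1 = (n.+1%:R^-1) ** (S n.+1 *+ n.+1).
  by rewrite -rats_nat ratsA mulVf // !scale1r.
rewrite S_Psi_rec (reindex_inj rev_ord_inj) scaler_sumr sum_compositions_last.
apply: eq_bigr => i _ /=; rewrite subSS subKn; last by rewrite -ltnS.
rewrite IH ?ltnS ?leq_subr // mulr_suml scaler_sumr; apply: eq_big_seq => J.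
rewrite mem_compositions0 => /andP[_ /eqP sJ].
rewrite -scalerAl ratsA /monom -cats1 big_cat big_seq1 cats1; congr ((_ *: _) *: _).
rewrite comp_pi_u_rcons sJ addnS subnK; last by rewrite -ltnS.
by rewrite natrM invfM mulrC.
Qed.

(** [S_Psi_rec] solved for [Psi_n]: prepending a part to a composition changes
    the sign and keeps the last part, and the one-part composition contributes
    the term [n S_n]. *)
Lemma Psi_S n : (0 < n)%N ->
  Psi n = - \sum_(L <- compositions n)
              ((-1) ^+ size L * (comp_lp L)%:R) ** monom S L.
Proof.
elim/ltn_ind: n => -[//|n] IH _; rewrite -/(compositions0 n.+1).
have -> : Psi n.+1 = S n.+1 *+ n.+1 - \sum_(i < n) S i.+1 * Psi (n - i).
  rewrite S_Psi_rec big_ord_recl S_coef0 mul1r subn0 -addrA -sumrB big1 ?addr0 //.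
  by move=> i _; rewrite lift0 subnSK // subrr.
rewrite sum_compositions_head big_ord_recr /= subnn (big_seq1 +%R) opprD addrC.
congr (_ + _); last first.
  by rewrite /monom big_seq1 mulN1r scaleNr scaleNr opprK rats_nat.
rewrite -!sumrN; apply: eq_bigr => i _; congr (- _).
(* a nonempty remainder, so that the last part is unchanged *)
have [m em] : exists m, (n - i = m.+1)%N.
  by exists (n - i).-1; rewrite prednK // subn_gt0.
rewrite IH ?ltnS ?leq_subr // ?subn_gt0 // em mulrN mulr_sumr -sumrN.
apply: eq_big_seq => -[|j J]; first by rewrite mem_compositions.
move=> _; rewrite -scalerAr -scaleNr -scaleNr /monom [in RHS]big_cons.
by rewrite [in RHS]exprS mulN1r mulNr.
Qed.

End Families.

(** * Change of family along refinements *)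

Lemma prod_compositions_sum (b : seq nat -> rat) (X : nat -> A) I :
  is_composition I ->
  \prod_(i <- I) (\sum_(J <- compositions i) b J ** monom X J) =
  \sum_(J <- compositions (sumn I) | refines J I)
     (\prod_(B <- blocks J I) b B) ** monom X J.
Proof.
move=> cI; rewrite sum_refines // prod_sum_blockings.
apply: eq_big_seq => Js hJs; rewrite flatten_blockingsK // rats_prod.
by rewrite /monom big_flatten.
Qed.

Lemma prod_opp (h : nat -> A) I :
  \prod_(i <- I) - h i = (-1) ^+ size I * \prod_(i <- I) h i.
Proof.
elim: I => [|i I IH]; first by rewrite !big_nil mul1r.
by rewrite !big_cons IH /= exprS mulN1r !mulNr mulrA commr_sign -mulrA.
Qed.

(** Two successive expansions over compositions compose into a double sum over
    chains of refinements, with weights multiplicative over blocks. *)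
Theorem monom_change (a b : seq nat -> rat) (X S Y : nat -> A) I :
    (forall n, (0 < n)%N -> S n = \sum_(J <- compositions n) b J ** monom X J) ->
    (forall n, (0 < n)%N -> Y n = - \sum_(L <- compositions n) a L ** monom S L) ->
    is_composition I ->
  monom Y I = (-1) ^+ size I *
    \sum_(J <- compositions (sumn I) | refines J I)
      (\sum_(L <- compositions (sumn I) | refines J L && refines L I)
         (\prod_(B <- blocks L I) a B) * \prod_(B <- blocks J L) b B) ** monom X J.
Proof.
move=> hS hY cI; have pI : all (ltn 0) I by case/andP: cI.
rewrite (eq_monom_pos pI hY) /monom prod_opp prod_compositions_sum //.
congr (_ * _).
transitivity (\sum_(L <- compositions (sumn I) | refines L I)
    \sum_(J <- compositions (sumn I) | refines J L)
      ((\prod_(B <- blocks L I) a B) * \prod_(B <- blocks J L) b B) ** monom X J).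
  rewrite big_seq_cond [RHS]big_seq_cond; apply: eq_bigr => L /andP[hL rLI].
  have cL : is_composition L by move: hL; rewrite mem_compositions => /andP[].
  have pL : all (ltn 0) L by case/andP: cL.
  rewrite (eq_monom_pos pL hS) /monom prod_compositions_sum //.
  rewrite -(refines_sumn rLI) scaler_sumr; apply: eq_bigr => J _.
  by rewrite ratsA.
rewrite (exchange_big_dep (fun J => refines J I)) /=; last first.
  by move=> L J rLI rJL; apply: refines_trans rLI.
apply: eq_bigr => J rJI; rewrite -in_algE rmorph_sum scaler_suml /=.
by apply: eq_bigl => L; rewrite andbC.
Qed.

Theorem Phi_Psi_relations (S Phi Psi : nat -> A) (I : seq nat) :
  fps_exp (fps_div_index Phi) =1 S ->
  fps_deriv S =1 fps_mul S (fps_shift Psi) ->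
  is_composition I ->
  monom Phi I =
    (-1) ^+ size I *
    \sum_(J <- compositions (sumn I) | refines J I)
      (\sum_(L <- compositions (sumn I) | refines J L && refines L I)
         (-1) ^+ size L * (comp_pi I)%:R /
         ((pi_u_rel J L)%:R * (size_rel L I)%:R) : rat)%:A *: monom Psi J
  /\
  monom Psi I =
    (-1) ^+ size I *
    \sum_(J <- compositions (sumn I) | refines J I)
      (\sum_(L <- compositions (sumn I) | refines J L && refines L I)
         (-1) ^+ size L * (lp_rel L I)%:R / (sp_rel J L)%:R : rat)%:A
      *: monom Phi J.
Proof.
move=> hPhi hPsi hI.
have signE L : refines L I ->
    \prod_(B <- blocks L I) (-1) ^+ size B = (-1) ^+ size L :> rat.
  move=> /and3P[_ _ /eqP fL]; rewrite -[in RHS]fL size_flatten sumnE big_map.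
  by rewrite expr_sum.
have piE L : refines L I ->
    \prod_(B <- blocks L I) (sumn B)%:R = (comp_pi I)%:R :> rat.
  by move=> /and3P[_ /eqP sL _]; rewrite /comp_pi -[in RHS]sL natr_prod big_map.
split.
  rewrite (monom_change (X := Psi) (S := S)
    (a := fun L => (-1) ^+ size L * (sumn L)%:R / (size L)%:R)
    (b := fun J => (comp_pi_u J)%:R^-1)) //; last exact: Phi_S hPhi.
    congr (_ * _); apply: eq_bigr => J _; congr ((_ *: _) *: _).
    apply: eq_bigr => L /andP[rJL rLI].
    rewrite !big_split /= signE // piE // !prodfV -!natr_prod invfM mulrA.
    by rewrite /pi_u_rel /size_rel [LHS]mulrAC.
  by case=> // n _; apply: S_Psi hPhi hPsi _.
rewrite (monom_change (X := Phi) (S := S)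
  (a := fun L => (-1) ^+ size L * (comp_lp L)%:R)
  (b := fun J => (comp_sp J)%:R^-1)) //; last exact: Psi_S hPhi hPsi.
  congr (_ * _); apply: eq_bigr => J _; congr ((_ *: _) *: _).
  apply: eq_bigr => L /andP[rJL rLI].
  by rewrite big_split /= signE // prodfV -!natr_prod.
by case=> // n _; apply: S_Phi hPhi _.
Qed.

End RationalCombinations.

Theorem mainTheorem9 (K : comAlgType rat) (S Phi Psi : nat -> NSym K)
  (hS_left : fps_mul (fps_opp_arg (Lambda K)) S =1 fps_one (NSym K))
  (hS_right : fps_mul S (fps_opp_arg (Lambda K)) =1 fps_one (NSym K))
  (hPhi : fps_exp (fps_div_index Phi) =1 S)
  (hPsi : fps_deriv S =1 fps_mul S (fps_shift Psi))
  (I : seq nat) (hI : is_composition I) :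
  monom Phi I =
    (-1) ^+ size I *
    \sum_(J <- compositions (sumn I) | refines J I)
      (\sum_(L <- compositions (sumn I) | refines J L && refines L I)
         (-1) ^+ size L * (comp_pi I)%:R /
         ((pi_u_rel J L)%:R * (size_rel L I)%:R) : rat)%:A *: monom Psi J
  /\
  monom Psi I =
    (-1) ^+ size I *
    \sum_(J <- compositions (sumn I) | refines J I)
      (\sum_(L <- compositions (sumn I) | refines J L && refines L I)
         (-1) ^+ size L * (lp_rel L I)%:R / (sp_rel J L)%:R : rat)%:A
      *: monom Phi J.
Proof. exact: (@Phi_Psi_relations K (NSym K) S Phi Psi I hPhi hPsi hI). Qed.
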